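(* Let $\{\mu_n\}_{n\geqslant0}$ be a sequence of real numbers such that $\det G_n\neq0$ for all $n\geqslant0$, where $G_n=[\mu_{i+j}]_{i,j=0}^n$. For $n\geqslant0$, let $S_n^{-1}\,H_n\,S_n^{-\top}$ be the Cholesky factorization of $G_n$ and let $\bar s_{n,0},\bar s_{n,1},\dots,\bar s_{n,n}$ denote the columns of $S_n^{\top}$. Let $$\bar s_{n,j}^{(1)}=\frac{1}{j+1}\,N_{n+1}\,\bar s_{n+1,j+1},\quad 0\leqslant j\leqslant n.$$ Then $\{\mu_n\}_{n\geqslant0}$ is classical if and only if there are real numbers $\kappa_j,\xi_j$, $j\geqslant0$, such that, for every $n\geqslant0$, $$\bar s_{n,j}=\bar s_{n,j}^{(1)}+\kappa_j\,\bar s_{n,j-1}^{(1)}+\xi_j\,\bar s_{n,j-2}^{(1)},\quad 0\leqslant j\leqslant n,$$ where, by convention, $\bar s_{n,-2}^{(1)}=\bar s_{n,-1}^{(1)}=\mathtt{0}$.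
   Context: A sequence of real numbers $\{\mu_n\}_{n\geqslant 0}$ with $\mu_0\neq0$ is pre-classical if there are real numbers $a,b,c,d,e$ with $|a|+|b|+|c|>0$ and $n\,a+d\neq0$ for all $n\geqslant0$, such that $(n\,a+d)\,\mu_{n+1}+(n\,b+e)\,\mu_n+n\,c\,\mu_{n-1}=0$ for all $n\geqslant0$ (with $\mu_n=0$ for $n<0$). It is classical if moreover $\det G_n\neq0$ for all $n\geqslant0$. The Cholesky factorization $G_n=S_n^{-1}H_nS_n^{-\top}$ is the unique one with $S_n$ (equivalently $S_n^{-1}$) unit lower triangular and $H_n$ nonsingular diagonal; $S_n^{-\top}=(S_n^{-1})^{\top}$. $N_{n}$, $n\geqslant 1$, is the $n\times(n+1)$ matrix (rows and columns indexed from $0$) with $(N_n)_{k,k+1}=k+1$ for $0\leqslant k\leqslant n-1$ and zeros elsewhere. $\mathtt{0}$ is the zero vector. *)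

(* Defs.v *)
From mathcomp Require Import all_boot all_order all_algebra.
From mathcomp Require Import reals.

Set Implicit Arguments.
Unset Strict Implicit.
Unset Printing Implicit Defensive.

Import Order.TTheory GRing.Theory Num.Theory.
Local Open Scope ring_scope.

Definition hankel (R : realType) (mu : nat -> R) (n : nat) : 'M[R]_n.+1 :=
  \matrix_(i < n.+1, j < n.+1) mu (i + j)%N.

(* The sequence extended to integer indices by mu_n = 0 for n < 0. *)
Definition moment (R : realType) (mu : nat -> R) (k : int) : R :=
  match k with Posz n => mu n | Negz _ => 0 end.

Definition preclassical (R : realType) (mu : nat -> R) : Prop :=
  mu 0%N != 0 /\
  exists a b c d e : R,
    [/\ 0 < `|a| + `|b| + `|c|,
        forall n : nat, n%:R * a + d != 0 &
        forall n : nat,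
          (n%:R * a + d) * moment mu (n%:Z + 1)
          + (n%:R * b + e) * moment mu n%:Z
          + n%:R * c * moment mu (n%:Z - 1) = 0].

Definition classical (R : realType) (mu : nat -> R) : Prop :=
  preclassical mu /\ forall n : nat, \det (hankel mu n) != 0.

Definition unit_lower_triangular (R : realType) (n : nat) (A : 'M[R]_n) : Prop :=
  is_trig_mx A /\ forall i : 'I_n, A i i = 1.

(* The factorization is parametrized by S, the inverse of the usual
   lower triangular factor. *)
Definition cholesky_factorization (R : realType) (n : nat) (G S H : 'M[R]_n) : Prop :=
  [/\ unit_lower_triangular S, is_diag_mx H, H \in unitmx &
      G = invmx S *m H *m (invmx S)^T].

Definition Nmx (R : realType) (n : nat) : 'M[R]_(n, n.+1) :=
  \matrix_(k < n, l < n.+1) (if l == k.+1 :> nat then k.+1%:R else 0).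

(* Because of inord, sbar S n j and sbar1 S n j are meaningful only for j <= n. *)
Definition sbar (R : realType) (S : forall n : nat, 'M[R]_n.+1) (n j : nat) :
    'cV[R]_n.+1 :=
  col (inord j) (S n)^T.

Definition sbar1 (R : realType) (S : forall n : nat, 'M[R]_n.+1) (n : nat) (j : int) :
    'cV[R]_n.+1 :=
  match j with
  | Posz i => i.+1%:R^-1 *: (Nmx R n.+1 *m sbar S n.+1 i.+1)
  | Negz _ => 0
  end.

(* Main.v *)
Require Import Defs.
From HB Require Import structures.
From mathcomp Require Import all_boot all_order all_algebra.
From mathcomp Require Import reals ring polyorder.

Set Implicit Arguments.
Unset Strict Implicit.
Unset Printing Implicit Defensive.

Import Order.TTheory GRing.Theory Num.Theory.
Local Open Scope ring_scope.

(** Row [j] of the unit lower triangular matrix [S n] lists the coefficients of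
    a monic polynomial of degree [j].  With [L] the linear functional on
    polynomials given by [L 'X^n = mu n], the factorization says that
    [S n *m hankel mu n *m (S n)^T = H n], that is, that these polynomials are
    orthogonal for the bilinear form [L (p * q)], with squared norms the diagonal
    entries of [H n].  Monic orthogonal polynomials being unique, they form one
    sequence [P 0, P 1, ...] that does not depend on [n]; so the vectors
    [sbar S n j] and [sbar1 S n j] list the coefficients of [P j] and of
    [Q j = (P j.+1)^`() / j.+1], and the vector identities amount to
      [P j = Q j + kappa j *: Q (j - 1) + xi j *: Q (j - 2)].

    On the other side, the three-term recurrence for the moments is the Pearson
    equation [L (phi * p^`() + psi * p) = 0] for all [p], tested on the powers
    of ['X], with [phi = a X^2 + b X + c] and [psi = d X + e].

    If the Pearson equation holds, then for [q] of degree at most [n]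
      [L (phi * (Q n * q))
         = - (n a + d) / (n + 1) * L (P n.+1 * P n.+1) * q`_n]
    ([pearson_dpoly]).  Hence the [Q n] are orthogonal for the functional
    [p |-> L (phi * p)].  Since [L (phi * P j * q) = 0] when [q] has degree less
    than [j - 2], only [Q j], [Q (j - 1)] and [Q (j - 2)] occur in the expansion
    of [P j]: this is [structure_relation_pearson].

    Conversely ([pearson_structure_relation]), let
      [phi = P 0 / h 0 + kappa 1 / h 1 * P 1 + xi 2 / h 2 * P 2] and
      [psi = - P 1 / h 1], where [h i = L (P i * P i)].
    Induction along the structure relation gives [L (phi * Q j) = (j == 0)],
    and this is the Pearson equation tested on the basis [P].  If
    [n a + d = 0], then [Q n] is orthogonal for [phi] to every polynomial of
    degree at most [n], and the structure relation for [P n.+2] gives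
    [a * h n.+2 = L (phi * Q n * P n.+2) = 0].  So [a = 0], hence [d = 0],
    although [d = - 1 / h 1]. *)

(** * Moment functionals *)

Section MomentFunctional.
Variables (K : comNzRingType) (mu : nat -> K).

(** The linear functional on polynomials that sends ['X^n] to [mu n]. *)
Definition moment_functional (p : {poly K}) : K := \sum_(i < size p) p`_i * mu i.

Lemma moment_functional_widen N (p : {poly K}) : (size p <= N)%N ->
  moment_functional p = \sum_(i < N) p`_i * mu i.
Proof.
move=> le_pN.
rewrite /moment_functional (big_ord_widen _ (fun i => p`_i * mu i) le_pN).
rewrite big_mkcond; apply: eq_bigr => i _.
by case: ltnP => // /leq_sizeP-> //; rewrite mul0r.
Qed.

Fact moment_functional_is_linear : scalar moment_functional.
Proof.
move=> a p q; set N := maxn (size p) (size q).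
have leP : (size p <= N)%N by rewrite leq_maxl.
have leQ : (size q <= N)%N by rewrite leq_maxr.
have lePQ : (size (a *: p + q)%R <= N)%N.
  rewrite (leq_trans (size_polyD _ _)) // geq_max leQ andbT.
  exact: leq_trans (size_scale_leq a (p : {poly K})) leP.
rewrite !(@moment_functional_widen N) // mulr_sumr -big_split /=.
by apply: eq_bigr => i _; rewrite coefD coefZ mulrDl mulrA.
Qed.

HB.instance Definition _ := GRing.isLinear.Build K {poly K} K _ moment_functional
  moment_functional_is_linear.

Lemma moment_functionalXn n : moment_functional 'X^n = mu n.
Proof.
rewrite /moment_functional size_polyXn big_ord_recr /= coefXn eqxx mul1r.
rewrite big1 ?add0r // => i _.
by rewrite coefXn (ltn_eqF (ltn_ord i)) mul0r.
Qed.

End MomentFunctional.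

Lemma poly_sumXn (K : nzRingType) N (p : {poly K}) : (size p <= N)%N ->
  p = \sum_(i < N) p`_i *: 'X^i.
Proof.
move=> szp; rewrite -poly_def; apply/polyP => i; rewrite coef_poly.
by case: ltnP => // le_Ni; rewrite (leq_sizeP _ _ szp).
Qed.

(** [linearZ] for a fixed functional: the generic lemma may instead be matched
    with another linear map, such as the opposite, inside the argument of [L]. *)
Lemma scalarZ (K : comNzRingType) (L : {scalar {poly K}}) a p :
  L (a *: p) = a * L p.
Proof. exact: linearZ. Qed.

Section Weight.
Variables (K : comNzRingType) (w : {poly K}) (L : {scalar {poly K}}).

(** The functional [L] multiplied by the polynomial [w]. *)
Definition weighted (p : {poly K}) : K := L (w * p).

Fact weighted_is_linear : scalar weighted.
Proof.
by move=> a p q; rewrite /weighted mulrDr -scalerAr linearP.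
Qed.

HB.instance Definition _ := GRing.isLinear.Build K {poly K} K _ weighted
  weighted_is_linear.

Lemma weightedE p : weighted p = L (w * p).
Proof. by []. Qed.

End Weight.

(** * Orthogonal polynomials *)

Section OrthogonalPolynomials.
Variables (K : fieldType) (L : {scalar {poly K}}).
Implicit Types (p q r : {poly K}) (F : nat -> {poly K}).

Lemma monic_coef m p : size p = m.+1 -> p \is monic -> p`_m = 1.
Proof. by move=> szp /monicP; rewrite lead_coefE szp. Qed.

Lemma size_subZ_lead m p q : size q = m.+1 -> q \is monic -> (size p <= m.+1)%N ->
  (size (p - p`_m *: q)%R <= m)%N.
Proof.
move=> szq /(monic_coef szq) q1 szp.
apply/leq_sizeP => i; rewrite leq_eqVlt => /predU1P[<-|lt_mi].
  by rewrite coefB coefZ q1 mulr1 subrr.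
rewrite coefB coefZ (leq_sizeP _ _ szp i) // (leq_sizeP _ _ (eq_leq szq)) //.
by rewrite mulr0 subrr.
Qed.

Lemma size_subr_monic m p q : size p = m.+1 -> p \is monic ->
  size q = m.+1 -> q \is monic -> (size (p - q)%R <= m)%N.
Proof.
move=> szp monp szq monq; have := size_subZ_lead szq monq (eq_leq szp).
by rewrite (monic_coef szp monp) scale1r.
Qed.

Lemma linear_eq0_monic_family F m :
  (forall k, (k < m)%N -> [/\ size (F k) = k.+1, F k \is monic & L (F k) = 0]) ->
  forall p, (size p <= m)%N -> L p = 0.
Proof.
elim: m => [|m IHm] hF p szp.
  by move: szp; rewrite leqn0 size_poly_eq0 => /eqP->; rewrite linear0.
have [szF monF LF] := hF m (ltnSn m).
rewrite -[p](subrK (p`_m *: F m)) linearD scalarZ LF mulr0 addr0.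
by apply: IHm (size_subZ_lead _ _ _) => // k lt_km; apply/hF/ltnW.
Qed.

(** [p] is a monic polynomial of degree [n], orthogonal to all polynomials of
    degree less than [n], and of nonzero (possibly negative) squared norm. *)
Definition orthopoly n p : Prop :=
  [/\ size p = n.+1, p \is monic,
      forall q, (size q <= n)%N -> L (p * q) = 0 & L (p * p) != 0].

Lemma orthopoly_coef n p q : orthopoly n p -> (size q <= n.+1)%N ->
  L (p * q) = q`_n * L (p * p).
Proof.
case=> szp monp orth _ szq.
rewrite -{1}[q](subrK (q`_n *: p)) mulrDr linearD /=.
rewrite orth ?add0r; last exact: size_subZ_lead.
by rewrite -scalerAr scalarZ.
Qed.

(** The form [L (p * q)] is nondegenerate in degrees less than [n]. *)
Lemma orthopoly_nondegenerate F n r : (forall k, (k < n)%N -> orthopoly k (F k)) ->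
  (size r <= n)%N -> (forall q, (size q <= n)%N -> L (r * q) = 0) -> r = 0.
Proof.
move=> oF szr r_orth; apply/eqP/negPn/negP => r_neq0.
have szr0 : (0 < size r)%N by rewrite size_poly_gt0.
have lt_kn : ((size r).-1 < n)%N by rewrite prednK.
have oFk := oF _ lt_kn; have [szF _ _ nF] := oFk.
have := orthopoly_coef (q := r) oFk; rewrite prednK // => /(_ (leqnn _)).
rewrite mulrC r_orth ?szF // => /esym/eqP; rewrite mulf_eq0 (negPf nF) orbF.
by rewrite -lead_coefE lead_coef_eq0 (negPf r_neq0).
Qed.

Lemma orthopoly_unique F n p q : (forall k, (k < n)%N -> orthopoly k (F k)) ->
  orthopoly n p -> orthopoly n q -> p = q.
Proof.
move=> oF [szp monp op _] [szq monq oq _].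
apply/eqP; rewrite -subr_eq0; apply/eqP/(orthopoly_nondegenerate oF).
  exact: size_subr_monic.
by move=> r szr; rewrite mulrBl linearB /= op ?oq ?subrr.
Qed.

End OrthogonalPolynomials.

(** * The Pearson equation and the structure relation *)

Section Pearson.
Variables (K : realFieldType) (L : {scalar {poly K}}).
Implicit Types (p q r : {poly K}).

(** Weak form of the Pearson equation [D (phi L) = psi L]. *)
Definition pearson (phi psi : {poly K}) : Prop :=
  forall p, L (phi * p^`() + psi * p) = 0.

(** The left-hand side of the Pearson equation as a linear functional. *)
Definition pearson_defect (phi psi p : {poly K}) : K :=
  L (phi * p^`() + psi * p).

Fact pearson_defect_is_linear phi psi : scalar (pearson_defect phi psi).
Proof.
move=> a p q; rewrite /pearson_defect derivD derivZ -scalarZ -linearD /=.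
by congr (L _); rewrite -!mul_polyC; ring.
Qed.

HB.instance Definition _ phi psi := GRing.isLinear.Build K {poly K} K _
  (pearson_defect phi psi) (pearson_defect_is_linear phi psi).

Definition quadratic (a b c : K) : {poly K} := a *: 'X^2 + b *: 'X + c%:P.
Definition affine (d e : K) : {poly K} := d *: 'X + e%:P.

Lemma size_quadratic a b c : (size (quadratic a b c) <= 3)%N.
Proof.
apply/leq_sizeP => i; case: i => [|[|[|i]]] // _.
by rewrite /quadratic !(coefD, coefZ, coefX, coefXn, coefC) /= !mulr0 !addr0.
Qed.

Lemma quadraticE p : (size p <= 3)%N -> p = quadratic p`_2 p`_1 p`_0.
Proof.
move=> szp; apply/polyP=> i.
rewrite /quadratic !(coefD, coefZ, coefX, coefXn, coefC).
case: i => [|[|[|i]]] /=; rewrite ?(mulr0, mulr1, addr0, add0r) //.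
exact: (leq_sizeP _ _ szp).
Qed.

Lemma affineE p : (size p <= 2)%N -> p = affine p`_1 p`_0.
Proof.
move=> szp; apply/polyP=> i; rewrite /affine !(coefD, coefZ, coefX, coefC).
case: i => [|[|i]] /=; rewrite ?(mulr0, mulr1, addr0, add0r) //.
exact: (leq_sizeP _ _ szp).
Qed.

Lemma pearson_monic_family phi psi (F : nat -> {poly K}) :
  (forall n, size (F n) = n.+1 /\ F n \is monic) ->
  (forall n, L (phi * (F n)^`() + psi * F n) = 0) -> pearson phi psi.
Proof.
move=> monF LF p; rewrite -/(pearson_defect phi psi p).
apply: (@linear_eq0_monic_family _ _ F (size p)) => // k _.
by have [szF mF] := monF k; split=> //; apply: LF.
Qed.

Variable (P : nat -> {poly K}).
Hypothesis oP : forall n, orthopoly L n (P n).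

(** The monic polynomial of degree [n] proportional to the derivative of
    [P n.+1]. *)
Definition dpoly n : {poly K} := n.+1%:R^-1 *: (P n.+1)^`().

Lemma size_dpoly n : size (dpoly n) = n.+1.
Proof.
have [szP _ _ _] := oP n.+1.
by rewrite size_scale ?invr_eq0 ?pnatr_eq0 // size_deriv szP.
Qed.

Lemma monic_dpoly n : dpoly n \is monic.
Proof.
have [szP monP _ _] := oP n.+1.
rewrite monicE lead_coefE size_dpoly /= coefZ coef_deriv.
by rewrite (monic_coef szP monP) mulVf ?pnatr_eq0.
Qed.

Lemma dpoly0 : dpoly 0 = 1.
Proof.
have szd := size_dpoly 0; have [c c_neq0 dE] := size_poly1P _ (introT eqP szd).
by have := monic_dpoly 0; rewrite dE monicE lead_coefC => /eqP->.
Qed.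

Lemma orthopoly0 : P 0 = 1.
Proof.
have [szP monP _ _] := oP 0; have [c c_neq0 dE] := size_poly1P _ (introT eqP szP).
by move: monP; rewrite dE monicE lead_coefC => /eqP->.
Qed.

(** The Pearson equation applied to [P n.+1 * q] moves the derivative onto
    [q], and turns the pairing of [dpoly n] and [q] under the weight [phi] into
    [- 1 / (n + 1)] times that of [P n.+1] and [psi * q + phi * q^`()].  The
    latter polynomial has degree at most [n.+1], and its coefficient in that
    degree is [(n a + d) * q`_n]. *)
Lemma pearson_dpoly a b c d e n q :
  pearson (quadratic a b c) (affine d e) -> (size q <= n.+1)%N ->
  L (quadratic a b c * (dpoly n * q)) =
  - (n.+1%:R^-1 * (n%:R * a + d) * L (P n.+1 * P n.+1)) * q`_n.
Proof.
move=> hL szq; set phi := quadratic a b c; set psi := affine d e.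
pose w := psi * q + phi * q^`().
have LPw : L (phi * ((P n.+1)^`() * q)) = - L (P n.+1 * w).
  have /eqP := hL (P n.+1 * q); rewrite derivM -/phi -/psi.
  have -> : phi * ((P n.+1)^`() * q + P n.+1 * q^`()) + psi * (P n.+1 * q) =
            phi * ((P n.+1)^`() * q) + P n.+1 * w by rewrite /w; ring.
  by rewrite linearD addr_eq0 => /eqP.
have wcoef i : w`_i.+1 = d * q`_i + e * q`_i.+1
     + (a * q`_i *+ i + b * q`_i.+1 *+ i.+1 + c * q`_i.+2 *+ i.+2).
  rewrite /w /psi /phi /affine /quadratic !mulrDl -!scalerAl !coefD !coefZ.
  rewrite !coefCM !coefXM !coefXnM !coef_deriv /=.
  case: i => [|i]; rewrite ?(mulr0n, mulr0) //= ?subn2 /= ?mulrnAr //.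
have szw : (size w <= n.+2)%N.
  apply/leq_sizeP => -[//|i]; rewrite ltnS => lt_ni; rewrite wcoef.
  have q0 k : (i <= k)%N -> q`_k = 0.
    by move=> le_ik; apply: (leq_sizeP _ _ szq); apply: leq_trans le_ik.
  by rewrite (q0 i) // (q0 i.+1) // (q0 i.+2) 1?ltnW // !(mulr0, mul0rn, addr0).
rewrite /dpoly -scalerAl -scalerAr scalarZ /= LPw.
rewrite (orthopoly_coef (oP n.+1) szw) wcoef.
have q0 := leq_sizeP _ _ szq.
rewrite (q0 n.+1) // (q0 n.+2) // !(mulr0, mul0rn, addr0) -mulr_natr; ring.
Qed.

Lemma orthopoly_dpoly a b c d e n :
  pearson (quadratic a b c) (affine d e) -> n%:R * a + d != 0 ->
  orthopoly (weighted (quadratic a b c) L) n (dpoly n).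
Proof.
move=> hL hn; have [_ _ _ hP] := oP n.+1; split=> [|||].
- exact: size_dpoly.
- exact: monic_dpoly.
- move=> q szq; rewrite /= weightedE (pearson_dpoly hL) ?(leqW szq) //.
  by rewrite (leq_sizeP _ _ szq) // mulr0.
rewrite /= weightedE (pearson_dpoly hL) ?size_dpoly //.
have := monic_dpoly n; rewrite monicE lead_coefE size_dpoly /= => /eqP->.
by rewrite mulr1 oppr_eq0 !mulf_neq0 ?invr_eq0 ?pnatr_eq0.
Qed.

(** The sequence [dpoly] extended by zero to negative indices. *)
Definition dpolyz (j : int) : {poly K} :=
  match j with Posz i => dpoly i | Negz _ => 0 end.

(** Each orthogonal polynomial is a combination of at most three consecutive
    normalized derivatives, with leading coefficient [1]. *)
Definition structure_relation (kappa xi : nat -> K) : Prop :=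
  forall j : nat,
    P j = dpolyz j%:Z + kappa j *: dpolyz (j%:Z - 1)
          + xi j *: dpolyz (j%:Z - 2).

(** For [j = 0] and [j = 1] some coefficients multiply a zero polynomial, and
    [j.-1], [j.-2] in their definitions then have no significance. *)
Lemma structure_relation_pearson a b c d e :
  pearson (quadratic a b c) (affine d e) -> (forall n : nat, n%:R * a + d != 0) ->
  exists kappa xi, structure_relation kappa xi.
Proof.
move=> hL hn; set phi := quadratic a b c.
(* Successive cancellation of the two top coefficients of [P j - dpoly j]. *)
pose kappa j := (P j - dpoly j)`_j.-1.
pose xi j := (P j - dpoly j - kappa j *: dpoly j.-1)`_j.-2.
exists kappa, xi => -[|[|j]].
- by rewrite /= !scaler0 !addr0 dpoly0 orthopoly0.
- rewrite /= scaler0 addr0 dpoly0; apply/eqP; rewrite addrC -subr_eq; apply/eqP.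
  have [szP monP _ _] := oP 1.
  have sz : (size (P 1 - dpoly 1)%R <= 1)%N.
    exact: size_subr_monic (size_dpoly 1) (monic_dpoly 1).
  by rewrite alg_polyC [LHS]size1_polyC.
have -> : (j.+2%:Z - 1 = j.+1)%R by rewrite -addn1 PoszD addrK.
have -> : (j.+2%:Z - 2 = j)%R by rewrite -addn2 PoszD addrK.
rewrite /=; apply/eqP; rewrite -subr_eq0; apply/eqP.
(* The remainder has degree less than [j] and is orthogonal, for the weight
   [phi], to all such polynomials. *)
have oQ k (_ : (k < j)%N) := orthopoly_dpoly hL (hn k).
have [szP monP orP _] := oP j.+2.
apply: (orthopoly_nondegenerate oQ).
  have sz2 := size_subr_monic szP monP (size_dpoly j.+2) (monic_dpoly j.+2).
  have sz1 := size_subZ_lead (size_dpoly j.+1) (monic_dpoly j.+1) sz2.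
  have := size_subZ_lead (size_dpoly j) (monic_dpoly j) sz1.
  by rewrite !opprD !addrA.
move=> q szq; rewrite /= weightedE -/phi.
have -> : phi * ((P j.+2 - (dpoly j.+2 + kappa j.+2 *: dpoly j.+1
                            + xi j.+2 *: dpoly j)) * q) =
    P j.+2 * (phi * q) - phi * (dpoly j.+2 * q)
      - kappa j.+2 *: (phi * (dpoly j.+1 * q)) - xi j.+2 *: (phi * (dpoly j * q)).
  by rewrite -!mul_polyC; ring.
have derivQ_orth i : (j <= i)%N -> L (phi * (dpoly i * q)) = 0.
  move=> le_ji; have [_ _ oi _] := orthopoly_dpoly hL (hn i).
  exact: oi (leq_trans szq le_ji).
rewrite !(raddfB L) /= !scalarZ !derivQ_orth ?leqnSn ?(ltnW (leqnSn _)) //.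
rewrite !(mulr0, subr0) orP //.
rewrite (leq_trans (size_polyMleq _ _)) // -subn1 leq_subLR.
by rewrite (leq_trans (leq_add (size_quadratic _ _ _) szq)) // addnC.
Qed.

Lemma pearson_structure_relation kappa xi : structure_relation kappa xi ->
  exists a b c d e,
    [/\ quadratic a b c != 0, forall n : nat, n%:R * a + d != 0 &
        pearson (quadratic a b c) (affine d e)].
Proof.
move=> hP.
pose h n := L (P n * P n).
have hn0 n : h n != 0 by have [] := oP n.
have P0 := orthopoly0; have Q0 := dpoly0.
have P1E : P 1 = dpoly 1 + kappa 1%N *: dpoly 0.
  by rewrite hP /= scaler0 addr0.
have PjE j : P j.+2 = dpoly j.+2 + kappa j.+2 *: dpoly j.+1 + xi j.+2 *: dpoly j.
  rewrite hP.
  have -> : (j.+2%:Z - 1 = j.+1)%R by rewrite -addn1 PoszD addrK.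
  by have -> : (j.+2%:Z - 2 = j)%R by rewrite -addn2 PoszD addrK.
(* The choice of [phi] makes [L (phi * P j)] equal to the value at [P j] of the
   functional that sends [dpoly 0] to [1] and the other [dpoly j] to [0]. *)
pose phi := (h 0)^-1 *: P 0 + (kappa 1 / h 1) *: P 1 + (xi 2 / h 2) *: P 2.
pose psi := - (h 1)^-1 *: P 1.
have szP n : size (P n) = n.+1 by have [] := oP n.
have orth i j : L (P i * P j) = (i == j)%:R * h i.
  wlog le_ij : i j / (i <= j)%N => [hw|].
    have /orP[le|le] := leq_total i j; first exact: hw.
    by rewrite mulrC hw // eq_sym; case: eqP => [->//|_]; rewrite !mul0r.
  case: eqP => [->|/eqP neq_ij]; first by rewrite mul1r.
  by have [_ _ o _] := oP j; rewrite mulrC o ?mul0r // szP ltn_neqAle neq_ij.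
have LphiP j : L (phi * P j) =
    (j == 0)%N%:R + kappa 1 * (j == 1)%N%:R + xi 2 * (j == 2)%N%:R.
  rewrite /phi !mulrDl -!scalerAl !linearD !scalarZ /= !orth.
  case: j => [|[|[|j]]] /=; rewrite ?(mul0r, mul1r, mulr0, mulr1) ?(addr0, add0r) //.
  - by rewrite mulVf.
  - by rewrite divfK.
  - by rewrite divfK.
have LphiZ k p : L (phi * (k *: p)) = k * L (phi * p).
  by rewrite -scalerAr scalarZ.
have LphiQ j : L (phi * dpoly j) = (j == 0)%N%:R.
  elim/ltn_ind: j => -[|[|j]] IHj.
  - by have := LphiP 0; rewrite P0 Q0 !mulr0 !addr0.
  - have := LphiP 1; rewrite P1E mulrDr linearD (LphiZ (kappa 1)) (IHj 0) //=.
    by rewrite mulr0 mulr1 addr0 add0r => /(canRL (addrK _)) ->; rewrite subrr.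
  have := LphiP j.+2; rewrite PjE !mulrDr !linearD.
  rewrite (LphiZ (kappa _)) (LphiZ (xi _)) (IHj j.+1) // (IHj j) 1?ltnW //=.
  rewrite !mulr0 addr0 !add0r => /(canRL (addrK _)) ->; case: j {IHj} => [|j] /=.
    by rewrite subrr.
  by rewrite !mulr0 subrr.
have szphi : (size phi <= 3)%N.
  rewrite !(leq_trans (size_polyD _ _)) // !geq_max; apply/andP; split; last first.
    by rewrite (leq_trans (size_scale_leq _ _)) ?szP.
  rewrite !(leq_trans (size_polyD _ _)) // !geq_max.
  by rewrite !(leq_trans (size_scale_leq _ _)) ?szP.
have szpsi : (size psi <= 2)%N by rewrite (leq_trans (size_scale_leq _ _)) ?szP.
have psiP j : L (psi * P j) = - (j == 1)%N%:R.
  rewrite /psi -scalerAl scalarZ orth [1%N == j]eq_sym.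
  by case: eqP; rewrite ?(mul0r, mulr0, oppr0) // mul1r mulNr mulVf.
have hpear : pearson phi psi.
  apply: (@pearson_monic_family _ _ P) => [n|[|n]].
  - by have [] := oP n.
  - by rewrite P0 derivC mulr0 add0r -P0 psiP oppr0.
  have -> : (P n.+1)^`() = n.+1%:R *: dpoly n.
    by rewrite scalerA divff ?scale1r // pnatr_eq0.
  rewrite linearD -scalerAr scalarZ /= LphiQ psiP eqSS.
  by case: n => [|n]; rewrite ?mulr1 ?mulr0 subrr.
have phiE := quadraticE szphi; have psiE := affineE szpsi.
set a := phi`_2 in phiE; set b := phi`_1 in phiE; set c := phi`_0 in phiE.
set d := psi`_1 in psiE; set e := psi`_0 in psiE.
exists a, b, c, d, e; rewrite -phiE -psiE; split=> // [|n].
  apply/eqP=> phi0; have := LphiP 0; rewrite phi0 mul0r linear0 /= !mulr0 !addr0.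
  by move=> /esym/eqP; rewrite oner_eq0.
apply/eqP => hn; rewrite phiE psiE in hpear.
have d_neq0 : d != 0.
  have [sz1 mon1 _ _] := oP 1.
  by rewrite /d /psi coefZ (monic_coef sz1 mon1) mulr1 oppr_eq0 invr_eq0.
have a_neq0 : a != 0.
  by apply: contra d_neq0 => /eqP a0; rewrite a0 mulr0 add0r in hn; apply/eqP.
have dpoly_small k : (n < k)%N -> (dpoly n)`_k = 0.
  by move=> lt_nk; apply: (leq_sizeP _ _ (eq_leq (size_dpoly n))).
(* [L (phi * dpoly n * P n.+2)] is [a * h n.+2] by orthogonality, and it is zero
   by the structure relation for [P n.+2], as [n a + d = 0]. *)
have cphi : (phi * dpoly n)`_n.+2 = a.
  rewrite phiE /quadratic !mulrDl -!scalerAl !coefD !coefZ coefCM coefXM coefXnM /=.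
  rewrite subn2 /= (monic_coef (size_dpoly n) (monic_dpoly n)).
  by rewrite (dpoly_small n.+1) // (dpoly_small n.+2) 1?ltnW // !mulr0 !addr0 mulr1.
have szphiQ : (size (phi * dpoly n)%R <= n.+3)%N.
  by rewrite (leq_trans (size_polyMleq _ _)) // size_dpoly addnS /= -add3n leq_add2r.
have := orthopoly_coef (oP n.+2) szphiQ; rewrite cphi {1}PjE.
have -> : (dpoly n.+2 + kappa n.+2 *: dpoly n.+1 + xi n.+2 *: dpoly n)
      * (phi * dpoly n) =
   phi * (dpoly n.+2 * dpoly n) + kappa n.+2 *: (phi * (dpoly n.+1 * dpoly n))
     + xi n.+2 *: (phi * (dpoly n * dpoly n)).
  by rewrite -!mul_polyC; ring.
rewrite !linearD !scalarZ /= phiE !(pearson_dpoly hpear) ?size_dpoly // 1?ltnW //.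
rewrite hn (dpoly_small n.+1) // (dpoly_small n.+2) 1?ltnW //.
rewrite !(mulr0, mul0r, oppr0, addr0) => /esym/eqP.
by rewrite mulf_eq0 (negPf a_neq0) (negPf (hn0 _)).
Qed.

End Pearson.

(** * The moment recurrence as a Pearson equation *)

Section Recurrence.
Variables (R : realType) (mu : nat -> R).

Lemma moment_pearsonXn a b c d e n :
  (n%:R * a + d) * moment mu (n%:Z + 1) + (n%:R * b + e) * moment mu n%:Z
    + n%:R * c * moment mu (n%:Z - 1)
  = moment_functional mu (quadratic a b c * ('X^n)^`() + affine d e * 'X^n).
Proof.
have LX k x : moment_functional mu (x *: 'X^k) = x * mu k.
  by rewrite scalarZ /= moment_functionalXn.
case: n => [|n].
  have -> : quadratic a b c * ('X^0)^`() + affine d e * 'X^0 = d *: 'X^1 + e *: 'X^0.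
    by rewrite derivXn mulr0n mulr0 add0r expr0 expr1 mulr1 alg_polyC.
  rewrite linearD /= !LX.
  by rewrite !mul0r !add0r addr0.
have -> : quadratic a b c * ('X^(n.+1))^`() + affine d e * 'X^(n.+1) =
    (n.+1%:R * a + d) *: 'X^(n.+2) + (n.+1%:R * b + e) *: 'X^(n.+1)
     + (n.+1%:R * c) *: 'X^n.
  rewrite derivXn /quadratic /affine -!mul_polyC !polyCD !polyCM !polyC_natr !exprS.
  by rewrite -mulr_natr; ring.
have -> : n.+1%:Z + 1 = n.+2%:Z by rewrite -PoszD addn1.
have -> : n.+1%:Z - 1 = n%:Z by rewrite -addn1 PoszD addrK.
by rewrite !linearD /= !LX.
Qed.

Lemma quadratic_neq0 (a b c : R) :
  (quadratic a b c != 0) = (0 < `|a| + `|b| + `|c|).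
Proof.
rewrite lt0r !addr_ge0 // andbT; congr (~~ _).
rewrite !paddr_eq0 ?addr_ge0 // !normr_eq0; apply/eqP/idP => [q0|].
  have qE k : (quadratic a b c)`_k = 0 by rewrite q0 coef0.
  move: (qE 0) (qE 1) (qE 2).
  rewrite /quadratic !(coefD, coefZ, coefX, coefXn, coefC) /=.
  by rewrite !(mulr0, mulr1, addr0, add0r) => -> -> ->; rewrite eqxx.
by case/andP=> /andP[/eqP-> /eqP->] /eqP->; rewrite /quadratic !scale0r !addr0.
Qed.

Lemma preclassical_pearson : mu 0%N != 0 ->
  preclassical mu <-> exists a b c d e : R,
    [/\ quadratic a b c != 0, forall n : nat, n%:R * a + d != 0 &
        pearson (moment_functional mu) (quadratic a b c) (affine d e)].
Proof.
move=> mu0; split=> [[_] |] [a [b [c [d [e [h1 h2 h3]]]]]].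
  exists a, b, c, d, e; split=> //; first by rewrite quadratic_neq0.
  apply: (@pearson_monic_family _ _ _ _ (fun n => 'X^n)) => n.
    by rewrite size_polyXn monicXn.
  by rewrite /= -moment_pearsonXn.
split=> //; exists a, b, c, d, e; split=> //; first by rewrite -quadratic_neq0.
by move=> n; rewrite moment_pearsonXn; apply: h3.
Qed.

End Recurrence.

(** * Cholesky factors of Hankel matrices *)

Section Cholesky.
Variables (R : realType) (mu : nat -> R).
Variables (S H : forall n : nat, 'M[R]_n.+1).
Hypothesis hSH : forall n : nat, cholesky_factorization (hankel mu n) (S n) (H n).
Let L : {scalar {poly R}} := moment_functional mu.

Lemma moment_functionalM N (p q : {poly R}) : (size p <= N)%N -> (size q <= N)%N ->
  L (p * q) = \sum_(i < N) \sum_(j < N) p`_i * mu (i + j)%N * q`_j.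
Proof.
move=> szp szq; rewrite {1}(poly_sumXn szp) {1}(poly_sumXn szq) mulr_suml.
rewrite linear_sum; apply: eq_bigr => i _; rewrite mulr_sumr linear_sum.
apply: eq_bigr => j _; rewrite -scalerAl -scalerAr -exprD !scalarZ.
rewrite -[L 'X^_]/(moment_functional mu _) moment_functionalXn.
by rewrite mulrA mulrAC.
Qed.

(** The polynomial whose coefficients form row [j] of [S n], for [j <= n]. *)
Definition row_poly n j : {poly R} := \poly_(k < n.+1) S n (inord j) (inord k).

Lemma coef_row_poly n j (k : 'I_n.+1) : (row_poly n j)`_k = S n (inord j) k.
Proof. by rewrite coef_poly ltn_ord inord_val. Qed.

Lemma size_row_poly n j : (size (row_poly n j) <= n.+1)%N.
Proof. exact: size_poly. Qed.

Lemma cholesky_congruence n : S n *m hankel mu n *m (S n)^T = H n.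
Proof.
have [[trigS diagS] _ _ ->] := hSH n.
have uS : S n \in unitmx by rewrite unitmxE det_trig // big1 ?unitr1.
by rewrite !mulmxA mulmxV // mul1mx -mulmxA -trmx_mul mulmxV // trmx1 mulmx1.
Qed.

Lemma moment_row_polyM n i j : (i <= n)%N -> (j <= n)%N ->
  L (row_poly n i * row_poly n j) = H n (inord i) (inord j).
Proof.
move=> le_in le_jn.
rewrite (moment_functionalM (size_row_poly _ _) (size_row_poly _ _)).
rewrite -cholesky_congruence mxE exchange_big /=; apply: eq_bigr => l _.
rewrite !mxE mulr_suml; apply: eq_bigr => k _.
by rewrite !coef_row_poly !mxE.
Qed.

Lemma row_poly_orthopoly n j : (j <= n)%N -> orthopoly L j (row_poly n j).
Proof.
have [[/is_trig_mxP trigS diagS] diagH unitH _] := hSH n.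
have coef1 i : (i <= n)%N -> (row_poly n i)`_i = 1.
  move=> le_in.
  by have := coef_row_poly i (inord i : 'I_n.+1); rewrite inordK // => ->.
have sz i : (i <= n)%N -> size (row_poly n i) = i.+1.
  move=> le_in; apply/eqP; rewrite eqn_leq; apply/andP; split.
    apply/leq_sizeP => k lt_ik; rewrite coef_poly; case: ltnP => // lt_kn.
    by rewrite trigS // !inordK.
  rewrite ltnNge; apply/negP => /leq_sizeP/(_ i (leqnn i))/eqP.
  by rewrite coef1 ?oner_eq0.
have mon i : (i <= n)%N -> row_poly n i \is monic.
  by move=> le_in; rewrite monicE lead_coefE sz //= coef1.
move=> le_jn; split; [exact: sz | exact: mon | | ].
  move=> q szq; rewrite -weightedE.
  apply: (@linear_eq0_monic_family _ _ (row_poly n)) szq => k lt_kj.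
  have le_kn : (k <= n)%N by rewrite (leq_trans (ltnW lt_kj)).
  split; [exact: sz | exact: mon | change (L (row_poly n j * row_poly n k) = 0)].
  rewrite moment_row_polyM //; move/is_diag_mxP: diagH; apply.
  by rewrite !inordK // neq_ltn lt_kj orbT.
rewrite moment_row_polyM //; move: unitH.
rewrite unitmxE det_trig ?is_diag_mx_is_trig // unitfE.
by move/prodf_neq0; apply.
Qed.

(** The monic orthogonal polynomial of degree [j] of the moment functional. *)
Definition monic_op j : {poly R} := row_poly j j.

Lemma monic_op_orthopoly j : orthopoly L j (monic_op j).
Proof. exact: row_poly_orthopoly. Qed.

(** Row [j] of [S n] does not depend on [n], up to padding by zeros. *)
Lemma row_polyE n j : (j <= n)%N -> row_poly n j = monic_op j.
Proof.
move=> le_jn.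
apply: (@orthopoly_unique _ L monic_op j) => [k _||].
- exact: monic_op_orthopoly.
- exact: row_poly_orthopoly.
- exact: monic_op_orthopoly.
Qed.

Lemma sbar_monic_op n j (i : 'I_n.+1) : (j <= n)%N ->
  sbar S n j i 0 = (monic_op j)`_i.
Proof. by move=> le_jn; rewrite -(row_polyE le_jn) coef_row_poly !mxE. Qed.

Lemma sbar1_dpolyz n (j : int) (i : 'I_n.+1) : j <= n%:Z ->
  sbar1 S n j i 0 = (dpolyz monic_op j)`_i.
Proof.
case: j => [j|j] le_jn; last by rewrite /= mxE coef0.
rewrite /sbar1 /dpolyz /dpoly !mxE coefZ coef_deriv; congr (_ * _).
rewrite (bigD1 (lift ord0 i)) //= big1 => [|l ne_li]; last first.
  rewrite mxE; case: eqP => [li|]; last by rewrite mul0r.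
  by case/eqP: ne_li; apply: val_inj.
by rewrite mxE eqxx addr0 sbar_monic_op // mulr_natl.
Qed.

Lemma sbar_structure_relation (kappa xi : nat -> R) :
  (forall n j : nat, (j <= n)%N ->
      sbar S n j = sbar1 S n j%:Z + kappa j *: sbar1 S n (j%:Z - 1)
                   + xi j *: sbar1 S n (j%:Z - 2))
  <-> structure_relation monic_op kappa xi.
Proof.
have leB (n j : nat) (m : nat) : (j <= n)%N -> j%:Z - m%:Z <= n%:Z.
  by move=> le_jn; rewrite lerBlDr (le_trans (y := n%:Z)) // lerDl.
have entryE n (i : 'I_n.+1) (u v w : 'cV[R]_n.+1) x y :
    (u + x *: v + y *: w) i 0 = u i 0 + x * v i 0 + y * w i 0.
  by rewrite !mxE.
have rhsE n j (i : 'I_n.+1) : (j <= n)%N ->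
    (sbar1 S n j%:Z + kappa j *: sbar1 S n (j%:Z - 1)
       + xi j *: sbar1 S n (j%:Z - 2)) i 0 =
    (dpolyz monic_op j%:Z + kappa j *: dpolyz monic_op (j%:Z - 1)
       + xi j *: dpolyz monic_op (j%:Z - 2))`_i.
  move=> le_jn; rewrite entryE !coefD (coefZ (kappa j)) (coefZ (xi j)).
  by rewrite !sbar1_dpolyz ?leB ?lez_nat.
split=> [hS j | hP n j le_jn].
  apply/polyP => i; set n := maxn i j.
  have le_in : (i < n.+1)%N by rewrite ltnS leq_maxl.
  have le_jn : (j <= n)%N by rewrite leq_maxr.
  by rewrite -(rhsE n j (Ordinal le_in)) // -hS // sbar_monic_op.
by apply/colP => i; rewrite rhsE // sbar_monic_op // {1}hP.
Qed.

End Cholesky.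

Theorem theorem5p12 (R : realType) (mu : nat -> R)
    (hdet : forall n : nat, \det (hankel mu n) != 0)
    (S H : forall n : nat, 'M[R]_n.+1)
    (hSH : forall n : nat, cholesky_factorization (hankel mu n) (S n) (H n)) :
  classical mu <->
  exists kappa xi : nat -> R,
    forall n j : nat, (j <= n)%N ->
      sbar S n j = sbar1 S n j%:Z + kappa j *: sbar1 S n (j%:Z - 1)
                   + xi j *: sbar1 S n (j%:Z - 2).
Proof.
have mu0 : mu 0%N != 0 by have := hdet 0; rewrite det_mx11 mxE.
have oP := monic_op_orthopoly hSH.
split=> [[/(preclassical_pearson mu0) [a [b [c [d [e [_ hn hL]]]]]] _]|].
  have [kappa [xi hP]] := structure_relation_pearson oP hL hn.
  by exists kappa, xi; apply/(sbar_structure_relation hSH).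
case=> kappa [xi /(sbar_structure_relation hSH) hP].
split=> //; apply/(preclassical_pearson mu0).
have [a [b [c [d [e [h1 h2 h3]]]]]] := pearson_structure_relation oP hP.
by exists a, b, c, d, e; split.
Qed.
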